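(* Let $H$ be an infinite dimensional Hilbert space. Then there exist three closed subspaces $L_1,L_2,L_3$ of $H$ such that (i) $L_1^{\perp}+L_2^{\perp}+L_3^{\perp}$ is not closed in $H$; (ii) for every $0\neq z_0\in H$ and every sequence $k_1,k_2,\dots\in\{1,2,3\}$, the sequence of iterates defined by $z_n=P(L_{k_n})z_{n-1}$, $n\geq1$, converges in norm.
   Context: For a closed subspace $X$ of $H$, $P(X)$ is the orthogonal projection of $H$ onto $X$, and $X^\perp$ is its orthogonal complement in $H$. *)

(* Defs.v *)
From mathcomp Require Import all_boot all_order all_algebra.
From mathcomp Require Import complex.
From mathcomp Require Import all_classical all_reals all_analysis.

Set Implicit Arguments.
Unset Strict Implicit.
Unset Printing Implicit Defensive.

Import Order.TTheory GRing.Theory Num.Theory.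
Import numFieldNormedType.Exports.

Local Open Scope classical_set_scope.
Local Open Scope ring_scope.

(* A Hilbert space is rendered as a complete normed module H over K together
   with an inner product ip : {dot H for conj} (linear on the left, conj-linear
   on the right) such that `|x| ^+ 2 = ip x x.  (K, conj) is one of the two
   cases below, so that real and complex Hilbert spaces are treated at once. *)
Inductive real_or_complex (R : realType) :
    forall K : numFieldType, (K -> K) -> Prop :=
| RealScalars : @real_or_complex R R idfun
| ComplexScalars : @real_or_complex R R[i]%C Num.conj.

Definition finite_dimensional (K : numFieldType) (V : lmodType K) : Prop :=
  exists (n : nat) (e : 'I_n -> V),
    forall x : V, exists a : 'I_n -> K, x = \sum_(i < n) a i *: e i.

Definition closed_subspace (K : numFieldType) (H : normedModType K)
    (X : set H) : Prop :=
  [/\ X 0, (forall (a : K) (x y : H), X x -> X y -> X (a *: x + y))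
    & closed X].

Section Orthogonality.
Context (K : numFieldType) (conj : K -> K) (H : normedModType K).
Context (ip : {dot H for conj}).

Definition orth_compl (X : set H) : set H :=
  [set x | forall y, X y -> ip x y = 0].

(* For a closed subspace X of a Hilbert space there is exactly one p in X with
   x - p orthogonal to X; the default value 0 is used only for other X. *)
Definition orth_proj (X : set H) (x : H) : H :=
  xget 0 [set p | X p /\ orth_compl X (x - p)].

End Orthogonality.

(* Main.v *)
Require Import Defs.
From mathcomp Require Import all_boot all_order all_algebra.
From mathcomp Require Import all_classical all_reals all_analysis.
From mathcomp Require Import complex ring.

Set Implicit Arguments.
Unset Strict Implicit.

Import Order.TTheory GRing.Theory Num.Theory.
Import numFieldNormedType.Exports.

Local Open Scope classical_set_scope.
Local Open Scope ring_scope.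

(** Two subspaces carry the whole difficulty, and the third is the whole of H:
    its orthogonal complement is 0 and its projection is the identity.

    Non-closedness.  Take an orthonormal sequence, split it as
    [base n], [side n], and put [tilted n = base n + 2^-n *: side n].  Let the
    first space be the orthogonal complement of all [base n] and the second that
    of all [tilted n].  The differences [tilted n - base n] put every partial
    sum of [x = sum_n 2^-n *: side n] in the sum of the orthogonal complements
    of these two spaces.  But if [x = u + v] with [u], [v] in the respective
    complements, then comparing coordinates on [side n] forces [v] to have
    coordinate 1 on every [base n] ([sum_coord_one]), which Bessel's inequality
    rules out ([bessel_ones]).

    Convergence.  For an orbit [z] of projections on two spaces, starting in one of them,
    moving projections from one side of the inner product to the other shows
    that, for [m <= n], the inner product of [z m] and [z n] equals
    [`|z j| ^+ 2] for some [j] between [m] and [n] ([orbit_ip]).  As norms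
    decrease along the orbit,
    [`|z m - z n| ^+ 2 <= `|z m| ^+ 2 - `|z n| ^+ 2] ([orbit_dist]), so [z] is
    a Cauchy sequence ([cvgn_of_drop]).

    Real and complex scalars are treated together, as an archimedean field
    with a ring morphism [conj] such that [`|a| ^+ 2 = a * conj a]. *)

(** * Nonincreasing sequences in an archimedean field *)

Section Archimedean.
Context (K : numFieldType).
Context (archiK : forall x : K, 0 <= x -> exists n : nat, x < n%:R).

(** Otherwise drops of size at least [eps] could be chained indefinitely, and
    [a 0] would exceed every multiple of [eps]. *)
Lemma nonincreasing_small_drop (a : nat -> K) (eps : K) :
  (forall n, 0 <= a n) -> (forall m n, (m <= n)%N -> a n <= a m) ->
  0 < eps -> exists N, forall n, (N <= n)%N -> a N - a n < eps.
Proof.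
move=> a_ge0 a_dec eps_gt0; apply: contrapT => noN.
have drop N : exists n, (N <= n)%N /\ a n + eps <= a N.
  apply: contrapT => nodrop; apply: noN; exists N => n Nn.
  have aNn_real : a N - a n \is Num.real by rewrite ger0_real ?subr_ge0 ?a_dec.
  rewrite real_ltNge ?(gtr0_real eps_gt0)//; apply/negP => le_eps.
  by apply: nodrop; exists n; split => //; rewrite addrC -lerBrDr.
have [next nextP] := choice drop.
have total k : a (iter k next 0%N) + eps *+ k <= a 0%N.
  elim: k => [|k IHk]; first by rewrite mulr0n addr0.
  apply: le_trans IHk; rewrite mulrS addrA lerD2r.
  by have [] := nextP (iter k next 0%N).
have [k] := archiK (divr_ge0 (a_ge0 0%N) (ltW eps_gt0)).
rewrite ltr_pdivrMr// mulr_natl => lt_k.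
have := le_lt_trans (total k) lt_k.
by rewrite gtrDr le_gtF.
Qed.

(** Here [a] plays the role of an energy whose decrease controls the squared
    distance travelled: it is the squared norm for an orbit of projections, and
    a multiple of the squared tail for an orthogonal series. *)
Lemma cvgn_of_drop (H : completeNormedModType K) (z : nat -> H) (a : nat -> K) :
  (forall n, 0 <= a n) ->
  (forall m n, (m <= n)%N -> `|z m - z n| ^+ 2 <= a m - a n) ->
  cvgn z.
Proof.
move=> a_ge0 dist_le.
have a_dec m n : (m <= n)%N -> a n <= a m.
  by move=> mn; rewrite -subr_ge0 (le_trans _ (dist_le m n mn))// exprn_ge0.
apply/cauchy_cvgP/cauchy_exP => eps eps_gt0.
have [N small] := nonincreasing_small_drop a_ge0 a_dec (exprn_gt0 2 eps_gt0).
exists (z N); exists N => //= n /= Nn.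
rewrite -ball_normE /ball_/=.
rewrite -(@ltr_pXn2r _ 2) ?nnegrE ?(ltW eps_gt0)//.
exact: le_lt_trans (dist_le _ _ Nn) (small _ Nn).
Qed.

End Archimedean.

(** * Inner product spaces over real or complex scalars *)
Section InnerProduct.
Context (K : numFieldType) (conj : {rmorphism K -> K}).
Context (normK : forall a : K, `|a| ^+ 2 = a * conj a).
Context (H : normedModType K) (ip : {dot H for conj}).
Context (Hnorm : forall x : H, `|x| ^+ 2 = ip x x).

Lemma conj_ge0 (a : K) : 0 <= a -> conj a = a.
Proof.
move=> a_ge0; have [->|a0] := eqVneq a 0; first by rewrite rmorph0.
by apply: (mulfI a0); rewrite -normK ger0_norm// expr2.
Qed.

Lemma ipC x y : ip x y = conj (ip y x).
Proof. by rewrite hermC expr0 mul1r. Qed.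

Lemma ip0l y : ip 0 y = 0. Proof. exact: linear0l. Qed.
Lemma ip0r x : ip x 0 = 0. Proof. exact: linear0r. Qed.
Lemma ipNl x y : ip (- x) y = - ip x y. Proof. exact: linearNl. Qed.
Lemma ipNr x y : ip x (- y) = - ip x y. Proof. exact: linearNr. Qed.
Lemma ipDl x y w : ip (x + y) w = ip x w + ip y w.
Proof. exact: linearDl. Qed.
Lemma ipDr w x y : ip w (x + y) = ip w x + ip w y.
Proof. exact: linearDr. Qed.
Lemma ipBl x y w : ip (x - y) w = ip x w - ip y w.
Proof. exact: linearBl. Qed.
Lemma ipBr w x y : ip w (x - y) = ip w x - ip w y.
Proof. exact: linearBr. Qed.
Lemma ipZl a x y : ip (a *: x) y = a * ip x y.
Proof. exact: linearZl_LR. Qed.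
Lemma ip_suml (I : finType) (F : I -> H) y :
  ip (\sum_i F i) y = \sum_i ip (F i) y.
Proof. exact: linear_sumlz. Qed.

Lemma ipZr a x y : ip x (a *: y) = conj a * ip x y.
Proof. by rewrite ipC ipZl rmorphM -ipC. Qed.

Lemma ip_eq0C x y : ip x y = 0 -> ip y x = 0.
Proof. by move=> xy; rewrite ipC xy rmorph0. Qed.

Lemma ip_self_eq0 x : ip x x = 0 -> x = 0.
Proof. by move/eqP; rewrite -Hnorm sqrf_eq0 normr_eq0 => /eqP. Qed.

Lemma pythagoras x y : ip x y = 0 -> `|x + y| ^+ 2 = `|x| ^+ 2 + `|y| ^+ 2.
Proof. by move=> xy; rewrite !Hnorm hnormDd. Qed.

(** The multiple [t *: y] is the orthogonal projection of [x] on the line of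
    [y], so its norm is at most that of [x]. *)
Lemma cauchy_schwarz x y : `|ip x y| <= `|x| * `|y|.
Proof.
have [->|y0] := eqVneq y 0; first by rewrite ip0r !normr0 mulr0.
have ny_gt0 : 0 < `|y| by rewrite normr_gt0.
have nz : `|y| ^+ 2 != 0 by rewrite expf_neq0// gt_eqF.
pose t := ip x y / `|y| ^+ 2.
have orth : ip (x - t *: y) (t *: y) = 0.
  by rewrite ipZr ipBl ipZl -Hnorm divfK// subrr mulr0.
have := pythagoras orth; rewrite subrK => splitx.
have : `|t *: y| ^+ 2 <= `|x| ^+ 2 by rewrite splitx lerDr exprn_ge0.
rewrite ler_pXn2r ?nnegrE// normrZ normrM normfV normrX normr_id.
by rewrite expr2 invfM mulrA divfK ?gt_eqF// ler_pdivrMr.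
Qed.

(** A point of the closure is approached by [p] with [ip p y = c], and by
    Cauchy-Schwarz [ip x y - c = ip (x - p) y] is then arbitrarily small. *)
Lemma closed_ip_eq (y : H) (c : K) : closed [set x | ip x y = c].
Proof.
move=> x clx /=; apply: contrapT => /eqP; rewrite -subr_eq0 -normr_gt0.
set d := `|_| => d_gt0.
(* The radius uses [`|y| + 1] in place of [`|y|] so that [y = 0] is covered. *)
have y1_gt0 : 0 < `|y| + 1 by rewrite ltr_wpDl.
have [p [/= pc]] := clx _ (nbhsx_ballx x _ (divr_gt0 d_gt0 y1_gt0)).
rewrite -ball_normE /ball_/= ltr_pdivlMr// => near_p.
have : d <= `|x - p| * `|y| by rewrite /d -pc -ipBl cauchy_schwarz.
have : `|x - p| * `|y| <= `|x - p| * (`|y| + 1) by rewrite ler_wpM2l// lerDl.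
by move=> le1 le2; have := le_lt_trans (le_trans le2 le1) near_p; rewrite ltxx.
Qed.

Lemma closed_subspace_orth_compl (X : set H) :
  closed_subspace (orth_compl ip X).
Proof.
split=> [y _|a x y xX yX w wX|]; first by rewrite ip0l.
  by rewrite ipDl ipZl xX// yX// mulr0 addr0.
rewrite (_ : orth_compl ip X = \bigcap_(y in X) [set x | ip x y = 0]).
  by apply: closed_bigI => y _; apply: closed_ip_eq.
by apply/seteqP; split.
Qed.

(** Two cases are enough for orbits: a nonzero value is a true orthogonal
    projection, and an orbit that reaches 0 stays there by [orth_proj0]. *)
Lemma orth_proj_cases (X : set H) x :
  orth_proj ip X x = 0 \/
  X (orth_proj ip X x) /\ orth_compl ip X (x - orth_proj ip X x).
Proof. by rewrite /orth_proj; case: xgetP => [p _|_]; [right|left]. Qed.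

Lemma orth_proj0 (X : set H) : orth_proj ip X 0 = 0.
Proof.
have [//|[Xp /(_ _ Xp)]] := orth_proj_cases X 0.
by rewrite sub0r ipNl => /eqP; rewrite oppr_eq0 => /eqP/ip_self_eq0.
Qed.

(** * Orbits of projections on two spaces *)

(** [b n] names a space containing [z n], and [z n.+1] is obtained from [z n] by
    projecting on the space named by [b n.+1].  Idle steps, with [z n.+1 = z n],
    are allowed: the label is then repeated. *)
Section AlternatingProjections.
Context (A : bool -> set H) (b : nat -> bool) (z : nat -> H).
Context (zA : forall n, A (b n) (z n)).
Context (z_orth : forall n, orth_compl ip (A (b n.+1)) (z n - z n.+1)).

Lemma step_same_space n : b n.+1 = b n -> z n.+1 = z n.
Proof.
move=> bn; apply/esym/subr0_eq/ip_self_eq0.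
by rewrite ipBr !z_orth ?subrr// bn.
Qed.

Lemma step_norm n : `|z n| ^+ 2 = `|z n - z n.+1| ^+ 2 + `|z n.+1| ^+ 2.
Proof. by rewrite -pythagoras ?subrK// z_orth. Qed.

Lemma orbit_norm_dec m n : (m <= n)%N -> `|z n| ^+ 2 <= `|z m| ^+ 2.
Proof.
elim: n => [|n IHn]; first by rewrite leqn0 => /eqP ->.
rewrite leq_eqVlt => /predU1P[->//|/IHn]; apply: le_trans.
by rewrite (step_norm n) lerDr exprn_ge0.
Qed.

(** Induction on [n - m].  If [z m.+1] and [z n] lie in the same space, then
    [z m - z m.+1] is orthogonal to [z n] and [m] can be raised; if [z m] and
    [z n] lie in the same space, then [z n.-1 - z n] is orthogonal to [z m] and
    [n] can be lowered.  With only two spaces, the one remaining possibility is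
    that [z m] and [z m.+1] share a space, hence coincide. *)
Lemma orbit_ip m n : (m <= n)%N ->
  exists j, (m <= j <= n)%N /\ ip (z m) (z n) = `|z j| ^+ 2.
Proof.
move: {2}(n - m)%N (erefl (n - m)%N) => d; elim: d m n => [|d IHd] m n.
  move=> /eqP; rewrite subn_eq0 => nm mn.
  have -> : n = m by apply/eqP; rewrite eqn_leq nm mn.
  by exists m; rewrite leqnn Hnorm.
case: n => [|n]; first by rewrite sub0n.
move=> dE; rewrite leq_eqVlt => /predU1P[mE|]; first by rewrite mE subnn in dE.
rewrite ltnS => mn.
have lower : ip (z m) (z n.+1) = ip (z m.+1) (z n.+1) ->
    exists j, (m <= j <= n.+1)%N /\ ip (z m) (z n.+1) = `|z j| ^+ 2.
  move=> ->; have [|//|j [/andP[mj jn] ->]] := IHd m.+1 n.+1.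
    by move: dE; rewrite subSS subSn// => -[].
  by exists j; rewrite (ltnW mj) jn.
have upper : ip (z m) (z n.+1) = ip (z m) (z n) ->
    exists j, (m <= j <= n.+1)%N /\ ip (z m) (z n.+1) = `|z j| ^+ 2.
  move=> ->; have [|//|j [/andP[mj jn] ->]] := IHd m n.
    by move: dE; rewrite subSn// => -[].
  by exists j; rewrite mj leqW.
have [bm1|bm1] := eqVneq (b m.+1) (b n.+1).
  apply: lower; apply/subr0_eq; rewrite -ipBl.
  by apply: z_orth; rewrite bm1.
have [bm|bm] := eqVneq (b m) (b n.+1).
  apply: upper; apply/esym/subr0_eq; rewrite -ipBr; apply: ip_eq0C.
  by apply: z_orth; rewrite -bm.
apply: lower; rewrite (@step_same_space m)//.
by move: bm1 bm; case: (b m.+1); case: (b m); case: (b n.+1).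
Qed.

(** Expand the square: the cross terms are [- `|z j| ^+ 2] twice for some
    [j] between [m] and [n], and [`|z n| <= `|z j|]. *)
Lemma orbit_dist m n : (m <= n)%N ->
  `|z m - z n| ^+ 2 <= `|z m| ^+ 2 - `|z n| ^+ 2.
Proof.
move=> mn; have [j [/andP[mj jn] zmn]] := orbit_ip mn.
have znm : ip (z n) (z m) = `|z j| ^+ 2.
  by rewrite ipC zmn conj_ge0// exprn_ge0.
rewrite Hnorm ipBl !ipBr zmn znm -!Hnorm.
have le_j : `|z n| ^+ 2 <= `|z j| ^+ 2 := orbit_norm_dec jn.
rewrite -subr_ge0 (_ : _ - _ = (`|z j| ^+ 2 - `|z n| ^+ 2) *+ 2).
  by rewrite mulrn_wge0// subr_ge0.
by rewrite mulr2n !opprB; ring.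
Qed.

End AlternatingProjections.

(** * Orthonormal sequences and Bessel's inequality *)
Section OrthonormalSequence.
Context (Hdim : ~ finite_dimensional H).

Definition orthonormal_upto (n : nat) (e : nat -> H) : Prop :=
  forall i j, (i < n)%N -> (j < n)%N -> ip (e i) (e j) = (i == j)%:R.

(** Gram-Schmidt: if the residual of every vector vanished, [e] would span the
    space; a nonzero residual only has to be normalized. *)
Lemma orthonormal_extend n (e : nat -> H) : orthonormal_upto n e ->
  exists y, ip y y = 1 /\ forall i, (i < n)%N -> ip y (e i) = 0.
Proof.
move=> e_on; apply: contrapT => noy; apply: Hdim.
exists n, (fun i : 'I_n => e i) => x; exists (fun i : 'I_n => ip x (e i)).
apply/subr0_eq/eqP/negPn/negP; set r := x - _ => r0; apply: noy.
have r_orth i : (i < n)%N -> ip r (e i) = 0.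
  move=> i_n; rewrite ipBl ip_suml (bigD1 (Ordinal i_n))//= big1.
    by rewrite addr0 ipZl e_on// eqxx mulr1 subrr.
  move=> j /negPf ji; rewrite ipZl e_on// [nat_of_ord j == i]ji.
  by rewrite mulr0.
exists (`|r|^-1 *: r); split=> [|i i_n].
  by rewrite -Hnorm normrZ normfV normr_id mulVf ?normr_eq0// expr1n.
by rewrite ipZl r_orth// mulr0.
Qed.

Lemma orthonormal_sequence :
  exists e : nat -> H, forall i j, ip (e i) (e j) = (i == j)%:R.
Proof.
have step (s : seq H) : exists y, orthonormal_upto (size s) (nth 0 s) ->
    ip y y = 1 /\ forall i, (i < size s)%N -> ip y (nth 0 s i) = 0.
  have [/orthonormal_extend[y yP]|nos] :=
    pselect (orthonormal_upto (size s) (nth 0 s)); last by exists 0.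
  by exists y.
have [next nextP] := choice step.
(* [S n] lists the first [n] vectors; the choice of the next one only looks at
   this list. *)
pose S n := iter n (fun s => rcons s (next s)) [::].
have sizeS n : size (S n) = n by elim: n => //= n IHn; rewrite size_rcons IHn.
have nthS n i : (i < n)%N -> nth 0 (S n) i = next (S i).
  elim: n => // n IHn; rewrite ltnS leq_eqVlt /= nth_rcons sizeS.
  by move=> /predU1P[->|i_n]; [rewrite ltnn eqxx|rewrite i_n IHn].
have S_on n : orthonormal_upto n (nth 0 (S n)).
  elim: n => // n IHn.
  have [] := nextP (S n); rewrite sizeS// => nn orth_n.
  move=> i j; rewrite !ltnS /= !nth_rcons !sizeS.
  rewrite (leq_eqVlt i) (leq_eqVlt j) => /predU1P[->|i_n];
    move=> /predU1P[->|j_n]; rewrite ?ltnn ?eqxx ?i_n ?j_n//.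
  - by rewrite orth_n// gtn_eqF.
  - by rewrite (ltn_eqF i_n) (ip_eq0C (orth_n i i_n)).
  - exact: IHn.
exists (fun n => next (S n)) => i j.
by rewrite -(@nthS (maxn i j).+1 i) -?(@nthS (maxn i j).+1 j) ?S_on ?ltnS
  ?leq_maxl ?leq_maxr.
Qed.

End OrthonormalSequence.

(** The case of Bessel's inequality in which all coordinates are 1: a vector of
    norm [`|v|] cannot have infinitely many of them. *)
Lemma bessel_ones (f : nat -> H) (v : H) :
  (forall i j, ip (f i) (f j) = (i == j)%:R) -> (forall n, ip v (f n) = 1) ->
  forall n, n%:R <= `|v| ^+ 2.
Proof.
move=> f_on vf n; rewrite -subr_ge0.
suff <- : `|v - \sum_(i < n) f i| ^+ 2 = `|v| ^+ 2 - n%:R by rewrite exprn_ge0.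
elim: n => [|n IHn]; first by rewrite big_ord0 !subr0.
apply/eqP; rewrite big_ord_recr/= opprD addrA -natr1 opprD addrA -IHn eq_sym.
set w := v - _.
have wf : ip (w - f n) (f n) = 0.
  rewrite !ipBl ip_suml big1 => [|i _].
    by rewrite vf f_on eqxx subr0 subrr.
  by rewrite f_on ltn_eqF.
have := pythagoras wf; rewrite subrK => ->.
by rewrite (Hnorm (f n)) f_on eqxx addrK.
Qed.

End InnerProduct.

(** * Two spaces whose orthogonal complements have a non-closed sum *)
Section Construction.
Context (K : numFieldType) (conj : {rmorphism K -> K}).
Context (normK : forall a : K, `|a| ^+ 2 = a * conj a).
Context (archiK : forall x : K, 0 <= x -> exists n : nat, x < n%:R).
Context (H : completeNormedModType K) (ip : {dot H for conj}).
Context (Hnorm : forall x : H, `|x| ^+ 2 = ip x x).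

Section TiltedPair.
Context (e : nat -> H) (e_on : forall i j, ip (e i) (e j) = (i == j)%:R).

Definition tilt (n : nat) : K := 2^-1 ^+ n.
Definition base n : H := e n.*2.
Definition side n : H := e n.*2.+1.
Definition tilted n : H := base n + tilt n *: side n.

Lemma conj_tilt n : conj (tilt n) = tilt n.
Proof. by rewrite (conj_ge0 normK)// exprn_ge0// invr_ge0. Qed.

Lemma tilt_neq0 n : tilt n != 0.
Proof. by rewrite expf_neq0// invr_eq0 pnatr_eq0. Qed.

Lemma base_base i j : ip (base i) (base j) = (i == j)%:R.
Proof. by rewrite e_on (inj_eq double_inj). Qed.

Lemma side_side i j : ip (side i) (side j) = (i == j)%:R.
Proof. by rewrite e_on eqSS (inj_eq double_inj). Qed.

Lemma base_side i j : ip (base i) (side j) = 0.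
Proof.
rewrite e_on; case: eqP => // /(congr1 odd).
by rewrite /= !odd_double.
Qed.

Lemma side_base i j : ip (side i) (base j) = 0.
Proof. exact: ip_eq0C (base_side j i). Qed.

Definition base_orth := orth_compl ip (range base).
Definition tilted_orth := orth_compl ip (range tilted).

Lemma orth_compl_sum (g : nat -> H) n :
  orth_compl ip (orth_compl ip (range g)) (\sum_(i < n) g i).
Proof.
move=> y yg; rewrite ip_suml big1// => i _.
by apply: ip_eq0C; apply: yg; exists (i : nat).
Qed.

(** Adding the term of index [n] increases the squared distance by
    [tilt n ^+ 2], that is by [4^-n], whereas [2 * 4^-n] drops by
    [(3 / 2) * 4^-n] from [n] to [n.+1]. *)
Lemma side_series_cvg : cvgn (fun n => \sum_(i < n) tilt i *: side i).
Proof.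
pose a n : K := tilt n ^+ 2 *+ 2.
have tilt2 n : 0 <= tilt n ^+ 2 by rewrite !exprn_ge0// invr_ge0.
apply: (@cvgn_of_drop K archiK H _ a) => [n|m n]; first by rewrite mulrn_wge0.
elim: n => [|n IHn].
  by rewrite leqn0 => /eqP ->; rewrite !subrr normr0 expr0n.
rewrite leq_eqVlt => /predU1P[->|/[dup] mn /IHn le_n].
  by rewrite !subrr normr0 expr0n.
rewrite big_ord_recr/= opprD addrA (pythagoras Hnorm)//; last first.
  rewrite ipNr ipZr ipBl !ip_suml !big1 ?subrr ?mulr0 ?oppr0//.
    by move=> i _; rewrite ipZl side_side ltn_eqF ?mulr0.
  move=> i _; rewrite ipZl side_side ltn_eqF ?mulr0//.
  exact: leq_trans (ltn_ord i) mn.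
rewrite normrN normrZ exprMn (Hnorm (side n)) side_side eqxx mulr1.
rewrite ger0_norm ?exprn_ge0 ?invr_ge0//.
apply: le_trans (lerD le_n (lexx _)) _.
have tiltS : tilt n.+1 = tilt n / 2 by rewrite /tilt exprS mulrC.
rewrite /a tiltS -subr_ge0 (_ : _ - _ = tilt n ^+ 2 / 2); last by field.
by rewrite divr_ge0.
Qed.

Lemma side_series_coord n :
  ip (limn (fun n => \sum_(i < n) tilt i *: side i)) (side n) = tilt n.
Proof.
have closed_coord := @closed_ip_eq _ _ _ _ Hnorm (side n) (tilt n).
have := @closed_cvg _ _ _ _ _ _ closed_coord _ _ side_series_cvg; apply.
exists n.+1 => // N /= nN.
rewrite ip_suml (bigD1 (Ordinal nN))//= big1.
  by rewrite ipZl side_side eqxx mulr1 addr0.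
by move=> i /negPf ni; rewrite ipZl side_side [nat_of_ord i == n]ni mulr0.
Qed.

(** Since [side n] is orthogonal to every [base i], it is orthogonal to [u], so
    [ip v (side n) = tilt n].  Since [tilt n *: base n - side n] is orthogonal
    to every [tilted i], it is orthogonal to [v], so
    [tilt n * ip v (base n) = ip v (side n)]. *)
Lemma sum_coord_one (u v : H) :
  orth_compl ip base_orth u -> orth_compl ip tilted_orth v ->
  (forall n, ip (u + v) (side n) = tilt n) -> forall n, ip v (base n) = 1.
Proof.
move=> uL1 vL2 uv n; apply: (mulIf (tilt_neq0 n)); rewrite mul1r.
have u_side : ip u (side n) = 0 by apply: uL1 => _ [i _ <-]; exact: side_base.
have : ip v (tilt n *: base n - side n) = 0.
  apply: vL2 => _ [i _ <-].
  rewrite ipBl ipZl !ipDr /= !ipZr base_base base_side.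
  rewrite side_base side_side mulr0 addr0 add0r conj_tilt.
  by have [->|] := eqVneq n i; rewrite ?subrr// !mulr0 subrr.
rewrite ipBr ipZr conj_tilt mulrC => /subr0_eq ->.
by have := uv n; rewrite ipDl u_side add0r.
Qed.

End TiltedPair.

(** * The three spaces *)

(** The index 2 falls outside the list, so it gets the default value [setT]. *)
Definition space (e : nat -> H) (i : 'I_3) : set H :=
  nth setT [:: base_orth e; tilted_orth e] i.

Lemma closed_subspace_space e i : closed_subspace (space e i).
Proof.
rewrite /space; case: i => [[|[|i]] ilt] /=.
- exact: closed_subspace_orth_compl.
- exact: closed_subspace_orth_compl.
- by rewrite nth_nil; split.
Qed.

Lemma sum_not_closed (e : nat -> H) :
  (forall i j, ip (e i) (e j) = (i == j)%:R) ->
  ~ closed [set u 0 + u 1 + u 2 | u in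
      [set u : 'I_3 -> H | forall i, orth_compl ip (space e i) (u i)]].
Proof.
move=> e_on; set S := (X in closed X) => Sclosed.
have : S (limn (fun n => \sum_(i < n) tilt i *: side e i)).
  have := @closed_cvg _ _ _ _ _ S Sclosed _ _ (side_series_cvg e_on); apply.
  apply: nearW => n.
  exists (fun i : 'I_3 => nth 0 [:: - \sum_(i < n) base e i;
                                   \sum_(i < n) tilted e i] i).
    case=> [[|[|[|i]]] ilt]//=.
    - by move=> y yL; rewrite ipNl orth_compl_sum ?oppr0.
    - exact: orth_compl_sum.
    - by move=> y _; rewrite ip0l.
  by rewrite /= addr0 big_split /= addKr.
case=> u uS sumu.
have u2 : u 2 = 0 by apply: (ip_self_eq0 Hnorm); apply: uS.
have ones : forall n, ip (u 1) (base e n) = 1.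
  apply: (sum_coord_one e_on (uS 0) (uS 1)) => n.
  by rewrite -(side_series_coord e_on) -sumu u2 addr0.
have [n] := archiK (exprn_ge0 2 (normr_ge0 (u 1))).
by rewrite le_gtF// (bessel_ones Hnorm (base_base e_on)).
Qed.

(** After the first projection on one of the first two spaces, idle steps can be
    absorbed by repeating the last label, which leaves an orbit of projections
    on two spaces. *)
Lemma three_step_cvg (L : 'I_3 -> set H) (k : nat -> 'I_3) (z : nat -> H) :
  L 2 = setT -> (forall n, z n.+1 = orth_proj ip (L (k n.+1)) (z n)) ->
  cvgn z.
Proof.
move=> LT zS.
have [[N zN]|z_neq0] := pselect (exists N, z N = 0).
  have z0 n : (N <= n)%N -> z n = 0.
    elim: n => [|n IHn]; first by rewrite leqn0 => /eqP <-.
    rewrite leq_eqVlt => /predU1P[<-//|/IHn zn0].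
    by rewrite zS zn0 (orth_proj0 Hnorm).
  by apply: (@is_cvg_near_cst _ _ 0); exists N.
have step n : L (k n.+1) (z n.+1) /\ orth_compl ip (L (k n.+1)) (z n - z n.+1).
  have [z0|] := orth_proj_cases ip (L (k n.+1)) (z n); last by rewrite -zS.
  by case: z_neq0; exists n.+1; rewrite zS.
have idle n : k n.+1 = 2 -> z n.+1 = z n.
  move=> k2; have [_] := step n; rewrite k2 LT => zn.
  by apply/esym/subr0_eq/(ip_self_eq0 Hnorm)/zn.
have [[N kN]|always_idle] := pselect (exists N, k N.+1 != 2); last first.
  apply: (@is_cvg_near_cst _ _ (z 0%N)); apply: nearW => n.
  elim: n => // n <-; apply: idle; apply/eqP/negPn/negP => kn.
  by apply: always_idle; exists n.
(* The label of [z (m + N.+1)] is the last index different from 2 used so far,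
   encoded as true for 1 and false for 0. *)
pose b := fun m => iteri m
  (fun i c => if k (i + N.+1).+1 == 2 then c else k (i + N.+1).+1 == 1)
  (k N.+1 == 1).
pose A (c : bool) := if c then L 1 else L 0.
have AL i : i != 2 -> A (i == 1) = L i.
  case: i => [[|[|[|i]]] ilt]//= _; congr L; exact: val_inj.
pose w n := z (n + N.+1)%N.
suff /cvg_ex[l]: cvgn w.
  by rewrite [_ --> _](cvg_shiftn N.+1 z) => zl; apply/cvg_ex; exists l.
apply: (@cvgn_of_drop K archiK H _ (fun n => `|w n| ^+ 2)).
  by move=> n; rewrite exprn_ge0.
have wA n : A (b n) (w n).
  elim: n => [|n IHn]; first by rewrite /w add0n /b/= AL//; have [] := step N.
  rewrite /w addSn /b /=; case: ifPn => [/eqP/idle -> //|kn].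
  by rewrite AL//; have [] := step (n + N.+1)%N.
apply: (orbit_dist normK Hnorm wA) => n.
rewrite /w addSn /b /=; case: ifPn => [/eqP/idle ->|kn].
  by rewrite subrr => y _; rewrite ip0l.
by rewrite AL//; have [] := step (n + N.+1)%N.
Qed.

Lemma three_spaces : ~ finite_dimensional H ->
  exists L : 'I_3 -> set H,
    [/\ forall i, closed_subspace (L i),
        ~ closed [set u 0 + u 1 + u 2 | u in
            [set u : 'I_3 -> H | forall i, orth_compl ip (L i) (u i)]]
      & forall (k : nat -> 'I_3) (z : nat -> H),
          z 0%N != 0 ->
          (forall n : nat, z n.+1 = orth_proj ip (L (k n.+1)) (z n)) ->
          cvgn z].
Proof.
move=> Hdim; have [e e_on] := orthonormal_sequence Hnorm Hdim.
exists (space e); split.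
- exact: closed_subspace_space.
- exact: sum_not_closed.
- by move=> k z _; apply: three_step_cvg.
Qed.

End Construction.

Lemma archimedean_complex (R : realType) (x : R[i]%C) :
  0 <= x -> exists n : nat, x < n%:R.
Proof.
move=> x_ge0; have /complex_realP[r xr] := ger0_real x_ge0.
move: x_ge0; rewrite {x}xr ler0c => /archi_boundP rn.
exists (Num.bound r); rewrite -(rmorph_nat (real_complex R)).
by rewrite ltcR.
Qed.

Unset Implicit Arguments.

Theorem mainTheorem7 (R : realType) (K : numFieldType) (conj : K -> K)
    (HK : real_or_complex R conj)
    (H : completeNormedModType K) (ip : {dot H for conj})
    (Hnorm : forall x : H, `|x| ^+ 2 = ip x x)
    (Hdim : ~ finite_dimensional H) :
  exists L : 'I_3 -> set H,
    [/\ forall i, closed_subspace (L i),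
        ~ closed [set u 0 + u 1 + u 2 | u in
            [set u : 'I_3 -> H | forall i, orth_compl ip (L i) (u i)]]
      & forall (k : nat -> 'I_3) (z : nat -> H),
          z 0%N != 0 ->
          (forall n : nat, z n.+1 = orth_proj ip (L (k n.+1)) (z n)) ->
          cvgn z].
Proof.
case: K conj / HK H ip Hnorm Hdim => H ip Hnorm Hdim.
- apply: (three_spaces _ _ Hnorm Hdim) => [a|x x_ge0].
    by rewrite real_normK ?num_real// expr2.
  by exists (Num.bound x); apply: archi_boundP.
- apply: (three_spaces _ _ Hnorm Hdim) => [a|]; first exact: normCK.
  exact: archimedean_complex.
Qed.
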